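(* If $\kappa$ is a cardinal number with $\kappa\ge\mathfrak c$, then there exists a nontrivial twisted sum of $c_0$ and $C(2^\kappa)$, where $2^\kappa=\{0,1\}^\kappa$ carries the product topology.
   Context: For a compact Hausdorff space $K$, $C(K)$ is the Banach space of continuous real-valued functions on $K$ with the supremum norm; $c_0$ is the Banach space of real sequences converging to zero. For Banach spaces $Y,X$, a twisted sum of $Y$ and $X$ is a short exact sequence $0\to Y\to Z\to X\to 0$ with $Z$ a Banach space and bounded linear maps; it is trivial if the image of $Y\to Z$ is complemented in $Z$. $\mathfrak c$ is the cardinality of the continuum. *)

(* Defs.v *)
From Stdlib Require Import Reals List.
Open Scope R_scope.

Record NormedSpace := {
  ns_car :> Type;
  ns_zero : ns_car;
  ns_add : ns_car -> ns_car -> ns_car;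
  ns_opp : ns_car -> ns_car;
  ns_scal : R -> ns_car -> ns_car;
  ns_norm : ns_car -> R;
  ns_add_assoc : forall x y z, ns_add x (ns_add y z) = ns_add (ns_add x y) z;
  ns_add_comm : forall x y, ns_add x y = ns_add y x;
  ns_add_0 : forall x, ns_add x ns_zero = x;
  ns_add_opp : forall x, ns_add x (ns_opp x) = ns_zero;
  ns_scal_assoc : forall a b x, ns_scal a (ns_scal b x) = ns_scal (a * b) x;
  ns_scal_1 : forall x, ns_scal 1 x = x;
  ns_scal_distr_v : forall a x y, ns_scal a (ns_add x y) = ns_add (ns_scal a x) (ns_scal a y);
  ns_scal_distr_s : forall a b x, ns_scal (a + b) x = ns_add (ns_scal a x) (ns_scal b x);
  ns_norm_eq0 : forall x, ns_norm x = 0 -> x = ns_zero;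
  ns_norm_scal : forall a x, ns_norm (ns_scal a x) = Rabs a * ns_norm x;
  ns_norm_triangle : forall x y, ns_norm (ns_add x y) <= ns_norm x + ns_norm y
}.

Arguments ns_zero {_}.
Arguments ns_add {_} _ _.
Arguments ns_opp {_} _.
Arguments ns_scal {_} _ _.
Arguments ns_norm {_} _.

Definition ns_dist {Z : NormedSpace} (x y : Z) : R := ns_norm (ns_add x (ns_opp y)).

Definition ns_cauchy {Z : NormedSpace} (u : nat -> Z) : Prop :=
  forall eps, 0 < eps -> exists N, forall m n, (N <= m)%nat -> (N <= n)%nat ->
    ns_dist (u m) (u n) < eps.

Definition ns_converges_to {Z : NormedSpace} (u : nat -> Z) (z : Z) : Prop :=
  forall eps, 0 < eps -> exists N, forall n, (N <= n)%nat -> ns_dist (u n) z < eps.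

Record Banach := {
  bs_ns :> NormedSpace;
  bs_complete : forall u : nat -> bs_ns, ns_cauchy u -> exists z, ns_converges_to u z
}.

Definition linear_subspace {Z : NormedSpace} (M : Z -> Prop) : Prop :=
  M ns_zero /\ (forall x y, M x -> M y -> M (ns_add x y)) /\
  (forall a x, M x -> M (ns_scal a x)).

Definition closed_set {Z : NormedSpace} (M : Z -> Prop) : Prop :=
  forall (u : nat -> Z) z, (forall n, M (u n)) -> ns_converges_to u z -> M z.

Definition complemented {Z : NormedSpace} (M : Z -> Prop) : Prop :=
  exists N : Z -> Prop, linear_subspace N /\ closed_set N /\
    (forall z, M z -> N z -> z = ns_zero) /\
    (forall z, exists m w, M m /\ N w /\ z = ns_add m w).

Definition c0 : Type := { y : nat -> R | Un_cv y 0 }.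

Definition supnorm_le {T : Type} (f : T -> R) (r : R) : Prop :=
  forall t, Rabs (f t) <= r.

(* 2^kappa = {0,1}^kappa, points are functions kappa -> bool.
   A basic open neighbourhood of x in the product topology is a cylinder
   {y | y k = x k for all k in a finite set F}. *)
Definition cylinder {kappa : Type} (x : kappa -> bool) (F : list kappa) (y : kappa -> bool) : Prop :=
  forall k, In k F -> y k = x k.

Definition prod_continuous {kappa : Type} (f : (kappa -> bool) -> R) : Prop :=
  forall x eps, 0 < eps -> exists F : list kappa,
    forall y, cylinder x F y -> Rabs (f y - f x) < eps.

Definition CK (kappa : Type) : Type := { f : (kappa -> bool) -> R | prod_continuous f }.

(* 0 -> c_0 --i--> Z --q--> C(2^kappa) -> 0, with Z Banach, i, q bounded linear,
   exact. Vector operations of c_0 and C(2^kappa) are pointwise, norms are sup norms. *)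
Record TwistedSum (kappa : Type) := {
  tw_Z : Banach;
  tw_i : c0 -> tw_Z;
  tw_q : tw_Z -> CK kappa;
  tw_i_linear : forall (a : R) (y1 y2 y3 : c0),
      (forall n, proj1_sig y3 n = proj1_sig y1 n + a * proj1_sig y2 n) ->
      tw_i y3 = ns_add (tw_i y1) (ns_scal a (tw_i y2));
  tw_i_bounded : exists M : R, forall (y : c0) (r : R),
      supnorm_le (proj1_sig y) r -> ns_norm (tw_i y) <= M * r;
  tw_q_linear : forall (a : R) (z1 z2 : tw_Z) t,
      proj1_sig (tw_q (ns_add z1 (ns_scal a z2))) t =
      proj1_sig (tw_q z1) t + a * proj1_sig (tw_q z2) t;
  tw_q_bounded : exists M : R, forall z : tw_Z,
      supnorm_le (proj1_sig (tw_q z)) (M * ns_norm z);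
  tw_i_inj : forall y1 y2 : c0, tw_i y1 = tw_i y2 -> forall n, proj1_sig y1 n = proj1_sig y2 n;
  tw_exact : forall z : tw_Z,
      (exists y : c0, tw_i y = z) <-> (forall t, proj1_sig (tw_q z) t = 0);
  tw_q_surj : forall f : CK kappa, exists z : tw_Z, forall t, proj1_sig (tw_q z) t = proj1_sig f t
}.

Arguments tw_Z {_} _.
Arguments tw_i {_} _ _.

Definition trivial_twisted_sum {kappa : Type} (T : TwistedSum kappa) : Prop :=
  complemented (fun z : tw_Z T => exists y : c0, tw_i T y = z).

(* Main.v *)
Require Import Defs.
From Stdlib Require Import Reals List.
From Stdlib Require Import Lra Lia Bool Arith Cantor Classical ClassicalEpsilon.
From Stdlib Require Import FunctionalExtensionality ProofIrrelevance.
From mathcomp Require filter.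
Set Bullet Behavior "Strict Subproofs".
Open Scope R_scope.

(** For a branch j of the tree of finite sequences of naturals and a natural a, let e_{a,j}
    be the difference of the evaluations at p_a + 1_{v j} and at p_a, where p_a = 1_{u a} and
    u, v embed the naturals and the branches into kappa with disjoint ranges. Sending f to the
    function whose value at the node (j 0, ..., j (m-1)) is e_{j m, j}(f) is a well defined
    bounded operator C(2^kappa) -> l_infty / c0: by continuity only finitely many j matter up
    to epsilon, and these eventually pass through different nodes. The twisted sum is the
    pullback of 0 -> c0 -> l_infty -> l_infty / c0 -> 0 along this operator.

    A closed complement of c0 would provide, by the open mapping theorem, a linear lifting
    C(2^kappa) -> l_infty with some bound C. Let U_a be the disjoint clopen sets where a is the
    least index with x (u a) = 1. The lift of 1_{U_a} x_{v j} is at least 1/2 at the node j|m if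
    j m = a and m is large with respect to j. A diagonal argument produces, for any M, a
    single node through which pass branches j_a (a < M), continuing with a, for which the
    node is already far enough. The sum of the functions 1_{U_a} x_{v j_a} has norm at most 1,
    but its lift is at least M/2 at this node. *)

(** * Choice principles *)

Lemma choice_on {A B : Type} (P : A -> B -> Prop) :
  (forall x, exists y, P x y) -> exists f, forall x, P x (f x).
Proof.
  intro H.
  exists (fun x => proj1_sig (constructive_indefinite_description _ (H x))).
  intro x. apply proj2_sig.
Qed.

Lemma dependent_choice {A : Type} (P : nat -> A -> Prop) (Q : nat -> A -> A -> Prop) (a0 : A) :
  P O a0 ->
  (forall n x, P n x -> exists y, P (S n) y /\ Q n x y) ->
  exists s, s O = a0 /\ forall n, P n (s n) /\ Q n (s n) (s (S n)).
Proof.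
  intros H0 HS.
  (* Making the requirement conditional on [P] lets [g] be total on all pairs. *)
  destruct (choice_on (fun (p : nat * A) y =>
              P (fst p) (snd p) -> P (S (fst p)) y /\ Q (fst p) (snd p) y)) as [g Hg].
  { intros [n x]; simpl. destruct (classic (P n x)) as [Hp|Hp].
    - destruct (HS n x Hp) as [y Hy]. now exists y.
    - now exists x. }
  set (s := fix s n := match n with O => a0 | S n => g (n, s n) end).
  assert (HP : forall n, P n (s n)).
  { intro n. induction n as [|n IH]; [exact H0|]. now apply (Hg (n, s n)). }
  exists s. split; [reflexivity|]. intro n. split; [apply HP|].
  now apply (Hg (n, s n)), HP.
Qed.

Lemma Rabs_le_bounds a b : Rabs a <= b -> - b <= a <= b.
Proof. intro H. pose proof (Rle_abs a). pose proof (Rle_abs (- a)). rewrite Rabs_Ropp in *. lra. Qed.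

(** * Uniform limits *)

Definition uniform_lim {T : Type} (F : nat -> T -> R) (f : T -> R) : Prop :=
  forall eps, 0 < eps -> exists N, forall n, (N <= n)%nat ->
    supnorm_le (fun t => F n t - f t) eps.

Lemma uniform_limit_exists {T : Type} (F : nat -> T -> R) :
  (forall eps, 0 < eps -> exists N, forall m n, (N <= m)%nat -> (N <= n)%nat ->
     supnorm_le (fun t => F m t - F n t) eps) ->
  exists f, uniform_lim F f.
Proof.
  intro HF.
  destruct (choice_on (fun t l => Un_cv (fun n => F n t) l)) as [f Hf].
  { intro t. destruct (R_complete (fun n => F n t)) as [l Hl]; [|now exists l].
    intros eps He. destruct (HF (eps / 2) ltac:(lra)) as [N HN].
    exists N. intros n m Hn Hm. unfold Rdist.
    specialize (HN n m Hn Hm t). simpl in HN. lra. }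
  exists f. intros eps He. destruct (HF (eps / 2) ltac:(lra)) as [N HN].
  exists N. intros n Hn t.
  destruct (Hf t (eps / 2) ltac:(lra)) as [N' HN'].
  specialize (HN' (Nat.max N N') ltac:(lia)).
  specialize (HN n (Nat.max N N') Hn ltac:(lia) t). simpl in HN.
  unfold Rdist in HN'.
  replace (F n t - f t) with
    ((F n t - F (Nat.max N N') t) + (F (Nat.max N N') t - f t)) by ring.
  eapply Rle_trans; [apply Rabs_triang|]. lra.
Qed.

Lemma half_pow_pos n : 0 < (/ 2) ^ n.
Proof. apply pow_lt. lra. Qed.

Lemma half_pow_small c eps : 0 < eps ->
  exists N, forall n, (N <= n)%nat -> c * (/ 2) ^ n < eps.
Proof.
  intro He.
  destruct (pow_lt_1_zero (/ 2)) with (y := eps / (Rabs c + 1)) as [N HN].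
  - rewrite Rabs_right; lra.
  - apply Rdiv_lt_0_compat; [lra|]. pose proof (Rabs_pos c). lra.
  - exists N. intros n Hn. specialize (HN n Hn).
    pose proof (half_pow_pos n) as Hp. rewrite Rabs_right in HN by lra.
    pose proof (Rabs_pos c). pose proof (Rle_abs c).
    apply (Rmult_lt_compat_r (Rabs c + 1)) in HN; [|lra].
    replace (eps / (Rabs c + 1) * (Rabs c + 1)) with eps in HN by (field; lra). nra.
Qed.

Lemma geometric_steps {T : Type} (F : nat -> T -> R) (c : R) :
  (forall n, supnorm_le (fun t => F (S n) t - F n t) (c * (/ 2) ^ n)) ->
  forall n k, supnorm_le (fun t => F (n + k)%nat t - F n t) (2 * c * (/ 2) ^ n).
Proof.
  intros HF n k t.
  assert (Hc : 0 <= c).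
  { specialize (HF O t). simpl in HF. pose proof (Rabs_pos (F 1%nat t - F O t)). lra. }
  (* The subtracted tail makes the induction on [k] close; it is dropped at the end. *)
  assert (H : Rabs (F (n + k)%nat t - F n t) <= 2 * c * ((/ 2) ^ n - (/ 2) ^ (n + k))).
  { induction k as [|k IH].
    - rewrite Nat.add_0_r, !Rminus_diag, Rabs_R0. lra.
    - rewrite Nat.add_succ_r.
      replace (F (S (n + k)) t - F n t) with
        ((F (S (n + k)) t - F (n + k)%nat t) + (F (n + k)%nat t - F n t)) by ring.
      eapply Rle_trans; [apply Rabs_triang|].
      specialize (HF (n + k)%nat t). simpl in HF |- *. lra. }
  pose proof (half_pow_pos (n + k)). nra.
Qed.

Lemma geometric_limit {T : Type} (F : nat -> T -> R) (c : R) :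
  (forall n, supnorm_le (fun t => F (S n) t - F n t) (c * (/ 2) ^ n)) ->
  exists f, uniform_lim F f.
Proof.
  intro HF. apply uniform_limit_exists. intros eps He.
  destruct (half_pow_small (2 * c) (eps / 2) ltac:(lra)) as [N HN].
  exists N. intros m n Hm Hn t.
  pose proof (geometric_steps F c HF N (m - N) t) as H1.
  pose proof (geometric_steps F c HF N (n - N) t) as H2.
  replace (N + (m - N))%nat with m in H1 by lia.
  replace (N + (n - N))%nat with n in H2 by lia.
  specialize (HN N ltac:(lia)). cbv beta in H1, H2 |- *.
  apply Rabs_le. apply Rabs_le_bounds in H1, H2. lra.
Qed.

Lemma uniform_lim_le {T : Type} (F : nat -> T -> R) (f g : T -> R) (c : R) (N : nat) :
  uniform_lim F f -> (forall n, (N <= n)%nat -> supnorm_le (fun t => F n t - g t) c) ->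
  supnorm_le (fun t => f t - g t) c.
Proof.
  intros HF Hb t. apply le_epsilon. intros eps He.
  destruct (HF eps He) as [N' HN'].
  specialize (HN' (Nat.max N N') ltac:(lia) t).
  specialize (Hb (Nat.max N N') ltac:(lia) t). cbv beta in *.
  apply Rabs_le. apply Rabs_le_bounds in HN', Hb. lra.
Qed.

(** * The open mapping theorem for a closed linear relation between function spaces *)

Section OpenMapping.
Context {A B : Type} (D : (A -> R) -> Prop) (G : (A -> R) -> (B -> R) -> Prop).
Hypothesis G_zero : G (fun _ => 0) (fun _ => 0).
Hypothesis G_linear : forall a f u g v, G f u -> G g v ->
  G (fun x => f x + a * g x) (fun y => u y + a * v y).
Hypothesis G_closed : forall F U f u, (forall n, G (F n) (U n)) ->
  uniform_lim F f -> uniform_lim U u -> G f u.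
Hypothesis G_bounded : forall f u, G f u -> exists r, supnorm_le u r.
Hypothesis G_domain : forall f, D f <-> exists u, G f u.
Hypothesis D_closed : forall F f, (forall n : nat, D (F n)) -> uniform_lim F f -> D f.

(** By [G_bounded] and [G_domain] these sets cover [D], as the Baire argument requires. *)
Let V (n : nat) (f : A -> R) : Prop := exists u, G f u /\ supnorm_le u (INR n).

Let D_linear a f g : D f -> D g -> D (fun x => f x + a * g x).
Proof.
  rewrite !G_domain. intros [u Hu] [v Hv]. eexists. exact (G_linear a _ _ _ _ Hu Hv).
Qed.

(** Otherwise one chooses nested balls with centres in [D] and radii at most (1/2)^n, ball n + 1
    avoiding [V n]. The limit of the centres lies in [D] and in all these balls, hence in no [V n],
    which contradicts the covering. *)
Let baire : exists n x r, 0 < r /\ D x /\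
  forall f, D f -> supnorm_le (fun t => f t - x t) r -> forall eps, 0 < eps ->
  exists g, V n g /\ supnorm_le (fun t => f t - g t) eps.
Proof.
  apply NNPP. intro Hno.
  destruct (dependent_choice
    (fun n (p : (A -> R) * R) => D (fst p) /\ 0 < snd p <= (/ 2) ^ n)
    (fun n p q => supnorm_le (fun t => fst q t - fst p t) (snd p - snd q) /\
       forall g, V n g -> ~ supnorm_le (fun t => g t - fst q t) (snd q))
    (fun _ => 0, 1)) as [s [_ Hs]].
  - simpl. split; [|lra]. apply G_domain. now exists (fun _ => 0).
  - intros n [x r] [Hx Hr]. simpl in Hx, Hr.
    apply NNPP. intro Hno'. apply Hno. exists n, x, (r / 2).
    split; [lra|]. split; [exact Hx|]. intros f Hf Hfx eps Heps.
    apply NNPP. intro Hno''. apply Hno'.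
    (* [f] is within r/2 of [x], so a radius of at most r/2 stays in the old ball; a radius of at
       most [eps] keeps [V n] outside. *)
    exists (f, Rmin eps (r / 2)).
    assert (Hm : 0 < Rmin eps (r / 2)) by (apply Rmin_glb_lt; lra).
    pose proof (Rmin_l eps (r / 2)). pose proof (Rmin_r eps (r / 2)).
    simpl. repeat split.
    + exact Hf.
    + exact Hm.
    + simpl in *. lra.
    + intro t. eapply Rle_trans; [apply Hfx|]. lra.
    + intros g Hg Hgf. apply Hno''. exists g. split; [exact Hg|].
      intro t. rewrite Rabs_minus_sym. eapply Rle_trans; [apply Hgf|]. lra.
  - assert (Hk : forall n k, supnorm_le (fun t => fst (s (n + k)%nat) t - fst (s n) t)
              (snd (s n) - snd (s (n + k)%nat))).
    { intros n k t. induction k as [|k IH].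
      - rewrite Nat.add_0_r, !Rminus_diag, Rabs_R0. lra.
      - rewrite Nat.add_succ_r. destruct (Hs (n + k)%nat) as [_ [H _]].
        specialize (H t). cbv beta in H, IH. apply Rabs_le_bounds in H, IH.
        apply Rabs_le. lra. }
    destruct (geometric_limit (fun n => fst (s n)) 1) as [f Hf].
    { intros n t. destruct (Hs n) as [[_ Hr] [H _]].
      destruct (Hs (S n)) as [[_ Hr'] _]. specialize (H t). cbv beta in H. lra. }
    assert (HD : D f).
    { apply (D_closed (fun n => fst (s n))); [|exact Hf]. intro n. apply Hs. }
    apply G_domain in HD as [u Hu].
    destruct (G_bounded f u Hu) as [r Hr].
    destruct (INR_unbounded r) as [n Hn].
    destruct (Hs n) as [_ [_ Hno']]. apply (Hno' f).
    + exists u. split; [exact Hu|]. intro y. specialize (Hr y). lra.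
    + apply (uniform_lim_le (fun n => fst (s n)) f _ _ (S n) Hf).
      intros m Hm t. specialize (Hk (S n) (m - S n)%nat t).
      replace (S n + (m - S n))%nat with m in Hk by lia.
      destruct (Hs m) as [[_ Hr'] _]. cbv beta in Hk. lra.
Qed.

(** [f] is t/r times the difference of x + (r/t) f and x, two points of the ball given by [baire].
    Approximating both from [V n] gives a value of size at most 2n, hence the constant 2n/r. *)
Let almost_open : exists C, 0 <= C /\
  forall t f eps, 0 < t -> 0 < eps -> D f -> supnorm_le f t ->
  exists g u, G g u /\ supnorm_le u (C * t) /\ supnorm_le (fun x => f x - g x) eps.
Proof.
  destruct baire as (n & x & r & Hr & Hx & Hb).
  pose proof (pos_INR n) as Hn.
  exists (2 * INR n / r). split.
  { apply Rmult_le_pos; [lra|]. left. now apply Rinv_0_lt_compat. }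
  intros t f eps Ht He Hf Hft.
  assert (Hrt : 0 < r / t) by now apply Rdiv_lt_0_compat.
  assert (Htr : 0 < t / r) by now apply Rdiv_lt_0_compat.
  assert (Hinv : t / r * (r / t) = 1) by (field; lra).
  assert (He' : 0 < eps * (r / t) / 2) by nra.
  destruct (Hb (fun y => x y + r / t * f y)) with (eps := eps * (r / t) / 2)
    as (g1 & (u1 & Hu1 & Hu1n) & Hg1); [now apply D_linear| |exact He'|].
  { intro y. replace (x y + r / t * f y - x y) with (r / t * f y) by ring.
    rewrite Rabs_mult, (Rabs_right (r / t)) by lra.
    apply Rle_trans with (r / t * t); [|right; field; lra].
    apply Rmult_le_compat_l; [lra|apply Hft]. }
  destruct (Hb x Hx) with (eps := eps * (r / t) / 2)
    as (g2 & (u2 & Hu2 & Hu2n) & Hg2); [|exact He'|].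
  { intro y. rewrite Rminus_diag, Rabs_R0. lra. }
  (* The leading [0 +] presents a scalar multiple in the form of [G_linear]. *)
  exists (fun y => 0 + t / r * (g1 y + (-1) * g2 y)),
    (fun y => 0 + t / r * (u1 y + (-1) * u2 y)).
  split; [|split].
  - exact (G_linear (t / r) _ _ _ _ G_zero (G_linear (-1) _ _ _ _ Hu1 Hu2)).
  - intro y. rewrite Rplus_0_l, Rabs_mult, (Rabs_right (t / r)) by lra.
    replace (2 * INR n / r * t) with (t / r * (2 * INR n)) by (field; lra).
    apply Rmult_le_compat_l; [lra|].
    specialize (Hu1n y). specialize (Hu2n y).
    apply Rabs_le_bounds in Hu1n, Hu2n. apply Rabs_le. lra.
  - intro y.
    replace (f y - (0 + t / r * (g1 y + -1 * g2 y))) with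
      (t / r * ((x y + r / t * f y - g1 y) - (x y - g2 y))) by (field; lra).
    rewrite Rabs_mult, (Rabs_right (t / r)) by lra.
    replace eps with (t / r * (eps * (r / t))) by (field; lra).
    apply Rmult_le_compat_l; [lra|].
    specialize (Hg1 y). specialize (Hg2 y). cbv beta in Hg1, Hg2.
    apply Rabs_le_bounds in Hg1, Hg2. apply Rabs_le. lra.
Qed.

(** Successive approximation: [almost_open] halves the bound on the residual at each step and
    corrects the value by at most C (1/2)^n. The corrections sum to at most 2C, and [G_closed]
    handles the limit. *)
Lemma open_mapping : exists C, forall f, D f -> supnorm_le f 1 ->
  exists u, G f u /\ supnorm_le u C.
Proof.
  destruct almost_open as (C & HC & Ho).
  exists (2 * C). intros f Hf Hf1.
  destruct (dependent_choice
    (fun n (p : (A -> R) * (B -> R)) => G (fst p) (snd p) /\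
       supnorm_le (fun t => fst p t - f t) ((/ 2) ^ n))
    (fun n p q => supnorm_le (fun t => snd q t - snd p t) (C * (/ 2) ^ n))
    (fun _ => 0, fun _ => 0)) as [s [Hs0 Hs]].
  - simpl. split; [exact G_zero|]. intro t.
    rewrite Rminus_0_l, Rabs_Ropp. apply Hf1.
  - intros n [g w] [Hg Hgf]. simpl in Hg, Hgf.
    destruct (Ho ((/ 2) ^ n) (fun t => f t + (-1) * g t) ((/ 2) ^ S n))
      as (h & v & Hhv & Hv & Hh).
    + apply half_pow_pos.
    + apply half_pow_pos.
    + apply D_linear; [exact Hf|]. apply G_domain. now exists w.
    + intro t. specialize (Hgf t). cbv beta in Hgf.
      apply Rabs_le_bounds in Hgf. apply Rabs_le. lra.
    + exists (fun t => g t + 1 * h t, fun t => w t + 1 * v t). cbn [fst snd].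
      split; [split|].
      * now apply G_linear.
      * intro t. specialize (Hh t). cbv beta in Hh. apply Rabs_le_bounds in Hh.
        apply Rabs_le. lra.
      * intro t. replace (w t + 1 * v t - w t) with (v t) by ring. apply Hv.
  - assert (Hstep : forall n, supnorm_le (fun t => snd (s (S n)) t - snd (s n) t) (C * (/ 2) ^ n))
      by (intro n; apply Hs).
    destruct (geometric_limit (fun n => snd (s n)) C Hstep) as [w Hw].
    exists w. split.
    + apply (G_closed (fun n => fst (s n)) (fun n => snd (s n)) f w); [|  |exact Hw].
      * intro n. apply Hs.
      * intros eps He. destruct (half_pow_small 1 eps He) as [N HN].
        exists N. intros n Hn t. destruct (Hs n) as [[_ H] _].
        specialize (H t). specialize (HN n Hn). cbv beta in H. lra.
    + intro t. replace (w t) with (w t - 0) by ring.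
      apply (uniform_lim_le (fun n => snd (s n)) w (fun _ => 0) (2 * C) O Hw).
      intros n _ y. pose proof (geometric_steps _ C Hstep O n y) as H.
      cbv beta in H. rewrite Hs0 in H. simpl in H. lra.
Qed.
End OpenMapping.


(** * Banach spaces of bounded functions *)

Lemma sup_norm_exists {T : Type} (f : T -> R) : (exists r, supnorm_le f r) ->
  exists N, 0 <= N /\ supnorm_le f N /\ forall r, 0 <= r -> supnorm_le f r -> N <= r.
Proof.
  intros [r Hr].
  (* The element 0 keeps the set nonempty when [T] is empty. *)
  destruct (completeness (fun x => x = 0 \/ exists t, x = Rabs (f t))) as [N [Hub Hlub]].
  - exists (Rmax 0 r). intros x [->|[t ->]]; [apply Rmax_l|].
    eapply Rle_trans; [apply Hr|apply Rmax_r].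
  - exists 0. now left.
  - exists N. split; [|split].
    + apply Hub. now left.
    + intro t. apply Hub. right. now exists t.
    + intros r' H0 Hr'. apply Hlub. intros x [->|[t ->]]; [exact H0|apply Hr'].
Qed.

Section FunctionSpace.
Context {T : Type} (E : (T -> R) -> Prop).
Hypothesis E_zero : E (fun _ => 0).
Hypothesis E_linear : forall a f g, E f -> E g -> E (fun t => f t + a * g t).
Hypothesis E_bounded : forall f, E f -> exists r, supnorm_le f r.
Hypothesis E_closed : forall F f, (forall n : nat, E (F n)) -> uniform_lim F f -> E f.

Let car : Type := { f : T -> R | E f }.

Lemma fs_ext (f g : car) : (forall t, proj1_sig f t = proj1_sig g t) -> f = g.
Proof.
  destruct f as [f Hf], g as [g Hg]. simpl. intro H.
  apply functional_extensionality in H. subst g. f_equal. apply proof_irrelevance.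
Qed.

Lemma fs_scal_mem a f : E f -> E (fun t => a * f t).
Proof.
  intro Hf. replace (fun t => a * f t) with (fun t => 0 + a * f t).
  - now apply (E_linear a (fun _ => 0) f).
  - apply functional_extensionality. intro t. ring.
Qed.

Lemma fs_add_mem f g : E f -> E g -> E (fun t => f t + g t).
Proof.
  intros Hf Hg. replace (fun t => f t + g t) with (fun t => f t + 1 * g t).
  - now apply E_linear.
  - apply functional_extensionality. intro t. ring.
Qed.

Let zero : car := exist _ _ E_zero.
Let scal (a : R) (f : car) : car := exist _ _ (fs_scal_mem a _ (proj2_sig f)).
Let add (f g : car) : car := exist _ _ (fs_add_mem _ _ (proj2_sig f) (proj2_sig g)).
Let opp (f : car) : car := scal (-1) f.
Let norm (f : car) : R := proj1_sig (constructive_indefinite_description _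
  (sup_norm_exists (proj1_sig f) (E_bounded _ (proj2_sig f)))).

Let norm_spec (f : car) : 0 <= norm f /\ supnorm_le (proj1_sig f) (norm f) /\
  forall r, 0 <= r -> supnorm_le (proj1_sig f) r -> norm f <= r.
Proof. unfold norm. apply proj2_sig. Qed.

Let norm_scal_le a (f : car) : norm (scal a f) <= Rabs a * norm f.
Proof.
  destruct (norm_spec f) as (H0 & Hf & _). apply norm_spec.
  - apply Rmult_le_pos; [apply Rabs_pos|exact H0].
  - intro t. simpl. rewrite Rabs_mult. apply Rmult_le_compat_l; [apply Rabs_pos|apply Hf].
Qed.

Definition function_space : NormedSpace.
Proof.
  refine {| ns_car := car; ns_zero := zero; ns_add := add; ns_opp := opp;
            ns_scal := scal; ns_norm := norm |}.
  1-8: intros; apply fs_ext; intro t; simpl; ring.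
  - intros f Hf. apply fs_ext. intro t. simpl.
    destruct (norm_spec f) as (_ & H & _). specialize (H t). rewrite Hf in H.
    apply Rabs_le_bounds in H. lra.
  - intros a f. apply Rle_antisym; [apply norm_scal_le|].
    destruct (Req_dec a 0) as [->|Ha].
    + rewrite Rabs_R0, Rmult_0_l. apply norm_spec.
    (* The reverse inequality is [norm_scal_le] for the inverse scalar. *)
    + assert (Hf : f = scal (/ a) (scal a f)).
      { apply fs_ext. intro t. simpl. now field. }
      rewrite Hf at 1.
      apply Rle_trans with (Rabs a * (Rabs (/ a) * norm (scal a f))).
      * apply Rmult_le_compat_l; [apply Rabs_pos|apply norm_scal_le].
      * rewrite <- Rmult_assoc, <- Rabs_mult, Rinv_r, Rabs_R1 by exact Ha. lra.
  - intros f g. destruct (norm_spec f) as (Hf0 & Hf & _).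
    destruct (norm_spec g) as (Hg0 & Hg & _). apply norm_spec; [lra|].
    intro t. simpl. eapply Rle_trans; [apply Rabs_triang|].
    apply Rplus_le_compat; [apply Hf|apply Hg].
Defined.

Lemma function_space_norm_bound (f : function_space) : supnorm_le (proj1_sig f) (ns_norm f).
Proof. apply norm_spec. Qed.

Lemma function_space_norm_le (f : function_space) r :
  0 <= r -> supnorm_le (proj1_sig f) r -> ns_norm f <= r.
Proof. apply norm_spec. Qed.

Lemma function_space_dist_bound (f g : function_space) :
  supnorm_le (fun t => proj1_sig f t - proj1_sig g t) (ns_dist f g).
Proof.
  intro t. replace (proj1_sig f t - proj1_sig g t)
    with (proj1_sig (ns_add f (ns_opp g)) t) by (simpl; ring).
  apply function_space_norm_bound.
Qed.

Lemma function_space_dist_le (f g : function_space) r : 0 <= r ->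
  supnorm_le (fun t => proj1_sig f t - proj1_sig g t) r -> ns_dist f g <= r.
Proof.
  intros H0 H. apply function_space_norm_le; [exact H0|]. intro t. simpl.
  replace (proj1_sig f t + -1 * proj1_sig g t) with (proj1_sig f t - proj1_sig g t) by ring.
  apply H.
Qed.

Lemma function_space_converges (u : nat -> function_space) (f : function_space) :
  uniform_lim (fun n => proj1_sig (u n)) (proj1_sig f) -> ns_converges_to u f.
Proof.
  intros H eps He. destruct (H (eps / 2) ltac:(lra)) as [N HN].
  exists N. intros n Hn. apply Rle_lt_trans with (eps / 2); [|lra].
  apply function_space_dist_le; [lra|]. now apply HN.
Qed.

Lemma function_space_complete (u : nat -> function_space) :
  ns_cauchy u -> exists f, ns_converges_to u f.
Proof.
  intro Hu. destruct (uniform_limit_exists (fun n => proj1_sig (u n))) as [f Hf].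
  - intros eps He. destruct (Hu eps He) as [N HN]. exists N. intros m n Hm Hn t.
    specialize (HN m n Hm Hn). left.
    eapply Rle_lt_trans; [apply (function_space_dist_bound (u m) (u n))|exact HN].
  - assert (HE : E f) by (apply (E_closed _ _ (fun n => proj2_sig (u n)) Hf)).
    exists (exist _ f HE). now apply function_space_converges.
Qed.

Definition function_banach : Banach :=
  {| bs_ns := function_space; bs_complete := function_space_complete |}.
End FunctionSpace.

(** * Continuous functions on a Cantor cube *)

Section Cube.
Context {kappa : Type}.
Implicit Types (f g : (kappa -> bool) -> R).

Lemma prod_continuous_zero : prod_continuous (fun _ : kappa -> bool => 0).
Proof. intros x eps He. exists nil. intros y _. rewrite Rminus_diag, Rabs_R0. exact He. Qed.

Lemma prod_continuous_linear a f g :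
  prod_continuous f -> prod_continuous g -> prod_continuous (fun x => f x + a * g x).
Proof.
  intros Hf Hg x eps He.
  assert (Ha : 0 <= Rabs a) by apply Rabs_pos.
  assert (He' : 0 < eps / 2 / (Rabs a + 1)) by (apply Rdiv_lt_0_compat; lra).
  destruct (Hf x (eps / 2) ltac:(lra)) as [F HF].
  destruct (Hg x _ He') as [F' HF'].
  exists (F ++ F'). intros y Hy.
  specialize (HF y (fun k Hk => Hy k (in_or_app _ _ _ (or_introl Hk)))).
  specialize (HF' y (fun k Hk => Hy k (in_or_app _ _ _ (or_intror Hk)))).
  replace (f y + a * g y - (f x + a * g x)) with ((f y - f x) + a * (g y - g x)) by ring.
  eapply Rle_lt_trans; [apply Rabs_triang|]. rewrite Rabs_mult.
  assert (Rabs a * Rabs (g y - g x) <= (Rabs a + 1) * (eps / 2 / (Rabs a + 1))).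
  { apply Rmult_le_compat; [exact Ha|apply Rabs_pos|lra|lra]. }
  replace ((Rabs a + 1) * (eps / 2 / (Rabs a + 1))) with (eps / 2) in H by (field; lra).
  lra.
Qed.

Lemma prod_continuous_lim (F : nat -> (kappa -> bool) -> R) f :
  (forall n, prod_continuous (F n)) -> uniform_lim F f -> prod_continuous f.
Proof.
  intros HF Hlim x eps He. destruct (Hlim (eps / 4) ltac:(lra)) as [N HN].
  specialize (HN N (Nat.le_refl N)).
  destruct (HF N x (eps / 4) ltac:(lra)) as [L HL].
  exists L. intros y Hy. specialize (HL y Hy).
  pose proof (HN x) as Hx. pose proof (HN y) as Hy'. cbv beta in Hx, Hy'.
  apply Rabs_le_bounds in Hx, Hy'. apply Rabs_def2 in HL. apply Rabs_def1; lra.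
Qed.

(* A function with |f (x n)| > n for all n is not locally bounded at the
   limit of the sequence x along an ultrafilter on nat. *)
Lemma prod_continuous_bounded f : prod_continuous f -> exists r, supnorm_le f r.
Proof.
  intro Hf. apply NNPP. intro Hno.
  destruct (choice_on (fun (n : nat) x => INR n < Rabs (f x))) as [x Hx].
  { intro n. apply NNPP. intro H. apply Hno. exists (INR n). intro t.
    apply Rnot_lt_le. intro Ht. apply H. now exists t. }
  destruct (filter.ultraFilterLemma filter.eventually_filter) as [U [HU Hev]].
  pose proof (filter.ultra_proper (UltraFilter := HU)) as HP.
  pose proof (filter.filter_filter (ProperFilter := HP)) as HFl.
  assert (Hup : forall P Q : nat -> Prop, (forall n, P n -> Q n) -> U P -> U Q).
  { intros P Q HPQ. exact (filter.filterS (F := U) HPQ). }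
  assert (Hcap : forall P Q : nat -> Prop, U P -> U Q -> U (fun n => P n /\ Q n)).
  { intros P Q HPU HQU. exact (filter.filterI (F := U) HPU HQU). }
  set (z := fun k => if excluded_middle_informative (U (fun n => x n k = true))
                     then true else false).
  destruct (Hf z 1 ltac:(lra)) as [L HL].
  (* Each coordinate of [x n] agrees with that of [z] for a set of [n] in [U], and [U] is closed
     under finite intersections. *)
  assert (Hz : U (fun n => cylinder z L (x n))).
  { clear HL. induction L as [|k L IH].
    - apply (Hup (fun _ => True)); [|exact (filter.filterT (F := U))].
      intros n _ k [].
    - assert (Hk : U (fun n => x n k = z k)).
      { unfold z. destruct (excluded_middle_informative _) as [H|H]; [exact H|].
        destruct (filter.in_ultra_setVsetC (fun n => x n k = true) HU) as [H'|H'];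
          [contradiction|].
        revert H'. apply Hup. intros n Hn. now apply not_true_is_false. }
      apply (Hup _ _) with (2 := Hcap _ _ Hk IH).
      intros n [H1 H2] k' [<-|Hk']; [exact H1|now apply H2]. }
  destruct (INR_unbounded (Rabs (f z) + 1)) as [N HN].
  assert (HUN : U (fun n => (N <= n)%nat)).
  { apply Hev. exists N; [exact I|]. intros n Hn. now apply (ssrbool.elimT ssrnat.leP). }
  destruct (classic (exists n, (N <= n)%nat /\ cylinder z L (x n))) as [[n [HNn Hn]]|Hemp].
  - specialize (HL _ Hn). specialize (Hx n). apply le_INR in HNn.
    pose proof (Rabs_triang (f (x n) - f z) (f z)) as Ht.
    replace (f (x n) - f z + f z) with (f (x n)) in Ht by ring. lra.
  - apply (filter.filter_not_empty U). apply (Hup _ _) with (2 := Hcap _ _ HUN Hz).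
    intros n Hn. exfalso. apply Hemp. now exists n.
Qed.
End Cube.


(** * Branches of the tree of finite sequences of natural numbers *)

(* [node j m] is a code for the finite sequence [j 0, ..., j (m - 1)]. *)
Fixpoint node (j : nat -> nat) (m : nat) : nat :=
  match m with O => O | S m => S (to_nat (j m, node j m)) end.

Lemma node_inj j m j' m' : node j m = node j' m' ->
  m = m' /\ forall i, (i < m)%nat -> j i = j' i.
Proof.
  revert m'. induction m as [|m IH]; intros [|m'] H; try discriminate H.
  - split; [reflexivity|]. intros i Hi. lia.
  - apply Nat.succ_inj in H. apply to_nat_inj in H. injection H as H0 H.
    destruct (IH m' H) as [-> Hlt]. split; [reflexivity|]. intros i Hi.
    destruct (Nat.eq_dec i m') as [->|Hne]; [exact H0|]. apply Hlt. lia.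
Qed.

(** This shows that a null sequence tends to zero along every branch. *)
Lemma node_ge j m : (m <= node j m)%nat.
Proof.
  induction m as [|m IH]; cbn [node]; [lia|].
  pose proof (to_nat_non_decreasing (j m) (node j m)). lia.
Qed.

(** For each member of [L] other than [j], [M] exceeds a place where it differs from [j]; a common
    node at level [M] or beyond would force agreement there. *)
Lemma node_eventually_separated (L : list (nat -> nat)) j : exists M, forall m, (M <= m)%nat ->
  forall j' m', In j' L -> node j' m' = node j m -> j' = j.
Proof.
  induction L as [|j0 L [M HM]].
  - exists O. intros m _ j' m' [].
  - destruct (classic (j0 = j)) as [->|Hne].
    + exists M. intros m Hm j' m' [<-|Hj'] Heq; [reflexivity|]. now apply (HM m Hm j' m').
    + assert (Hi : exists i, j0 i <> j i).
      { apply not_all_ex_not. intro H. apply Hne. now apply functional_extensionality. }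
      destruct Hi as [i Hi]. exists (Nat.max M (S i)). intros m Hm j' m' [<-|Hj'] Heq.
      * apply node_inj in Heq as [-> Heq]. exfalso. apply Hi, Heq. lia.
      * apply (HM m ltac:(lia) j' m' Hj' Heq).
Qed.

(* Otherwise, every node has a child all of whose branches have [N] larger than
   the level of the node; following these children yields a branch with infinite [N]. *)
Lemma branches_at_common_node (M : nat) (N : (nat -> nat) -> nat) :
  exists s m, forall a, (a < M)%nat -> exists j, node j m = s /\ j m = a /\ (N j <= m)%nat.
Proof.
  apply NNPP. intro Hno.
  destruct (choice_on (fun s a => forall j m, node j m = s -> j m = a -> (m < N j)%nat))
    as [f Hf].
  { intro s. apply NNPP. intro Hs. apply Hno.
    destruct (classic (exists j m, node j m = s)) as [[j0 [m Hm]]|Hempty].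
    - exists s, m. intros a _. apply NNPP. intro Ha. apply Hs. exists a.
      intros j m' Hj Hja. destruct (node_inj j m' j0 m) as [-> _]; [now rewrite Hj|].
      apply Nat.lt_nge. intro Hle. apply Ha. now exists j.
    (* A number that codes no node satisfies the condition vacuously. *)
    - exfalso. apply Hs. exists O. intros j m Hj. exfalso. apply Hempty. now exists j, m. }
  set (c := fix c m := match m with O => O | S m => S (to_nat (f (c m), c m)) end).
  set (j := fun m => f (c m)).
  assert (Hc : forall m, node j m = c m).
  { intro m. induction m as [|m IH]; [reflexivity|]. cbn [node]. rewrite IH. reflexivity. }
  (* At its own level [N j] the diagonal branch takes the bad label, so [N j < N j]. *)
  specialize (Hf (c (N j)) j (N j) (Hc _) eq_refl). lia.
Qed.

(** * Finite preimages, near suprema and small linear combinations *)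

Lemma injective_preimage_finite {A B : Type} (g : A -> B) (F : list B) :
  (forall x y, g x = g y -> x = y) -> exists L, forall x, In (g x) F -> In x L.
Proof.
  intro Hg. induction F as [|b F [L HL]].
  - exists nil. intros x [].
  - destruct (classic (exists x, g x = b)) as [[x0 <-]|Hno].
    + exists (x0 :: L). intros x [Hx|Hx]; [left; now apply Hg|right; now apply HL].
    + exists L. intros x [Hx|Hx]; [|now apply HL]. exfalso. apply Hno. now exists x.
Qed.

(** A supremum need not be attained, but half of a positive one is exceeded; if [g] vanishes on [P],
    any point serves. This selects a dominant branch through each node. *)
Lemma near_maximizer {A : Type} (P : A -> Prop) (g : A -> R) (r : R) :
  (exists x, P x) -> supnorm_le g r ->
  exists x, P x /\ forall y, P y -> Rabs (g y) <= 2 * Rabs (g x).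
Proof.
  intros [x0 Hx0] Hg.
  destruct (classic (exists x1, P x1 /\ g x1 <> 0)) as [[x1 [Hx1 Hne]]|Hz].
  - destruct (completeness (fun s => exists x, P x /\ s = Rabs (g x))) as [s [Hub Hlub]].
    + exists r. intros s [x [_ ->]]. apply Hg.
    + exists (Rabs (g x0)). now exists x0.
    + assert (Hs : 0 < s).
      { apply Rlt_le_trans with (Rabs (g x1)); [now apply Rabs_pos_lt|].
        apply Hub. now exists x1. }
      apply NNPP. intro Hno. assert (s <= s / 2); [|lra].
      apply Hlub. intros s' [x [Hx ->]]. apply Rnot_lt_le. intro Hlt. apply Hno.
      exists x. split; [exact Hx|]. intros y Hy.
      apply Rle_trans with s; [|lra]. apply Hub. now exists y.
  - exists x0. split; [exact Hx0|]. intros y Hy.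
    replace (g y) with 0.
    + rewrite Rabs_R0. pose proof (Rabs_pos (g x0)). lra.
    + apply NNPP. intro H. apply Hz. exists y. split; [exact Hy|]. now apply not_eq_sym.
Qed.

Lemma small_linear_combination (a eps : R) : 0 < eps -> exists d, 0 < d /\
  forall x y, Rabs x <= d -> Rabs y <= d -> Rabs (x + a * y) <= eps.
Proof.
  intro He. pose proof (Rabs_pos a) as Ha.
  assert (Hd : 0 < eps / (Rabs a + 1)) by (apply Rdiv_lt_0_compat; lra).
  exists (eps / (Rabs a + 1)). split; [exact Hd|]. intros x y Hx Hy.
  eapply Rle_trans; [apply Rabs_triang|]. rewrite Rabs_mult.
  apply (Rmult_le_compat_l (Rabs a)) in Hy; [|exact Ha].
  replace eps with (eps / (Rabs a + 1) + Rabs a * (eps / (Rabs a + 1))) by (field; lra).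
  lra.
Qed.

(** * The twisted sum *)

Definition indicator {kappa : Type} (P : kappa -> Prop) (k : kappa) : bool :=
  if excluded_middle_informative (P k) then true else false.

Lemma indicator_true {kappa : Type} (P : kappa -> Prop) k : P k -> indicator P k = true.
Proof. intro H. unfold indicator. now destruct (excluded_middle_informative _). Qed.

Lemma indicator_false {kappa : Type} (P : kappa -> Prop) k : ~ P k -> indicator P k = false.
Proof. intro H. unfold indicator. now destruct (excluded_middle_informative _). Qed.

Section Construction.
Context {kappa : Type} (u : nat -> kappa) (v : (nat -> nat) -> kappa).
Hypothesis u_inj : forall a b, u a = u b -> a = b.
Hypothesis v_inj : forall i j, v i = v j -> i = j.
Hypothesis uv_disjoint : forall a j, u a <> v j.

Definition jump (f : (kappa -> bool) -> R) (a : nat) (j : nat -> nat) : R :=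
  f (indicator (fun k => k = u a \/ k = v j)) - f (indicator (fun k => k = u a)).

(** Continuity at the zero point settles all [a] with [u a] outside a finite set [F]. Each of the
    finitely many other [a] needs continuity at 1_{u a}, which excludes finitely many further
    [j]. *)
Lemma jump_small f eps : prod_continuous f -> 0 < eps ->
  exists L, forall j, ~ In j L -> forall a, Rabs (jump f a j) <= eps.
Proof.
  intros Hf He.
  destruct (Hf (fun _ => false) (eps / 2) ltac:(lra)) as [F HF].
  destruct (injective_preimage_finite u F u_inj) as [As HAs].
  destruct (injective_preimage_finite v F v_inj) as [L0 HL0].
  assert (HL1 : exists L1, forall j, ~ In j L1 -> forall a, In a As -> Rabs (jump f a j) <= eps).
  { clear HAs. induction As as [|a As [L1 HL1]].
    - exists nil. intros j _ a [].
    - destruct (Hf (indicator (fun k => k = u a)) eps He) as [Fa HFa].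
      destruct (injective_preimage_finite v Fa v_inj) as [La HLa].
      exists (La ++ L1). intros j Hj b [<-|Hb].
      + left. apply HFa. intros k Hk.
        destruct (classic (k = u a)) as [Hka|Hka].
        * rewrite !indicator_true by tauto. reflexivity.
        * rewrite !indicator_false; [reflexivity|exact Hka|]. intros [H|H]; [now apply Hka|].
          subst k. apply Hj, in_or_app. left. now apply HLa.
      + apply HL1; [|exact Hb]. intro H. apply Hj, in_or_app. now right. }
  destruct HL1 as [L1 HL1].
  exists (L0 ++ L1). intros j Hj a. destruct (classic (In a As)) as [Ha|Ha].
  - apply HL1; [|exact Ha]. intro H. apply Hj, in_or_app. now right.
  - assert (H1 : Rabs (f (indicator (fun k => k = u a)) - f (fun _ => false)) < eps / 2).
    { apply HF. intros k Hk. apply indicator_false. intros ->. now apply Ha, HAs. }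
    assert (H2 : Rabs (f (indicator (fun k => k = u a \/ k = v j)) - f (fun _ => false)) < eps / 2).
    { apply HF. intros k Hk. apply indicator_false. intros [->| ->].
      - now apply Ha, HAs.
      - apply Hj, in_or_app. left. now apply HL0. }
    unfold jump. apply Rabs_def2 in H1, H2. apply Rabs_le. lra.
Qed.

(* Modulo [c0], [w] is the image of [f] under a bounded operator from C(2^kappa)
   to l_infty / c0: the value at the node [s] is [jump f a j] if the branch [j]
   passes through [s] and its child with label [a]. This is meaningful since, up to [eps],
   only finitely many [j] matter and each pair of them separates eventually. *)
Definition lifts (f : (kappa -> bool) -> R) (w : nat -> R) : Prop :=
  (forall j eps, 0 < eps -> exists N, forall m, (N <= m)%nat ->
     Rabs (w (node j m) - jump f (j m) j) <= eps) /\
  (forall eps, 0 < eps -> exists (L : list (nat -> nat)) N, forall n, (N <= n)%nat ->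
     (forall j m, In j L -> node j m <> n) -> Rabs (w n) <= eps).

Lemma lifts_linear a f w g z : lifts f w -> lifts g z ->
  lifts (fun x => f x + a * g x) (fun n => w n + a * z n).
Proof.
  intros [Hf1 Hf2] [Hg1 Hg2]. split.
  - intros j eps He. destruct (small_linear_combination a eps He) as (d & Hd & Hsmall).
    destruct (Hf1 j d Hd) as [N HN]. destruct (Hg1 j d Hd) as [N' HN'].
    exists (Nat.max N N'). intros m Hm.
    replace (w (node j m) + a * z (node j m) - jump (fun x => f x + a * g x) (j m) j)
      with ((w (node j m) - jump f (j m) j) + a * (z (node j m) - jump g (j m) j))
      by (unfold jump; ring).
    apply Hsmall; [apply HN|apply HN']; lia.
  - intros eps He. destruct (small_linear_combination a eps He) as (d & Hd & Hsmall).
    destruct (Hf2 d Hd) as (L & N & HN). destruct (Hg2 d Hd) as (L' & N' & HN').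
    exists (L ++ L'), (Nat.max N N'). intros n Hn Hoff. apply Hsmall.
    + apply HN; [lia|]. intros j m Hj. apply Hoff, in_or_app. now left.
    + apply HN'; [lia|]. intros j m Hj. apply Hoff, in_or_app. now right.
Qed.

(** This gives exactness at the middle term. The second clause of [lifts] controls [w] off finitely
    many branches; on each of these the first clause controls all but finitely many nodes. *)
Lemma lifts_zero w : lifts (fun _ => 0) w <-> Un_cv w 0.
Proof.
  split.
  - intros [H1 H2] eps He. destruct (H2 (eps / 2) ltac:(lra)) as (L & N & HN).
    assert (HL : exists N', forall j m, In j L -> (N' <= node j m)%nat ->
              Rabs (w (node j m)) <= eps / 2).
    { clear HN. induction L as [|j0 L [N' HN']].
      - exists O. intros j m [].
      - destruct (H1 j0 (eps / 2) ltac:(lra)) as [M HM].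
        (* [N0] exceeds the codes of the first [M] nodes of [j0], so a node with code at least [N0]
           has level at least [M]. *)
        set (N0 := S (list_max (map (node j0) (seq 0 M)))).
        exists (Nat.max N' N0). intros j m [<-|Hj] Hm; [|apply HN'; [exact Hj|lia]].
        destruct (Nat.le_gt_cases M m) as [HMm|HMm].
        + specialize (HM m HMm). unfold jump in HM. now rewrite Rminus_diag, Rminus_0_r in HM.
        + exfalso. assert (node j0 m <= list_max (map (node j0) (seq 0 M)))%nat; [|lia].
          pose proof (proj1 (list_max_le (map (node j0) (seq 0 M)) _) (Nat.le_refl _)) as Hall.
          rewrite Forall_forall in Hall. apply Hall, in_map, in_seq. lia. }
    destruct HL as [N' HN'].
    exists (Nat.max N N'). intros n Hn. unfold Rdist. rewrite Rminus_0_r.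
    apply Rle_lt_trans with (eps / 2); [|lra].
    destruct (classic (exists j m, In j L /\ node j m = n)) as [(j & m & Hj & <-)|Hoff].
    + apply HN'; [exact Hj|lia].
    + apply HN; [lia|]. intros j m Hj Hjm. apply Hoff. now exists j, m.
  - intro Hw. split.
    + intros j eps He. destruct (Hw eps He) as [N HN]. exists N. intros m Hm.
      unfold jump. rewrite Rminus_diag. left. apply HN.
      pose proof (node_ge j m). lia.
    + intros eps He. destruct (Hw eps He) as [N HN]. exists nil, N. intros n Hn _.
      specialize (HN n Hn). unfold Rdist in HN. rewrite Rminus_0_r in HN. lra.
Qed.

Lemma lifts_lim F W f w : (forall n, lifts (F n) (W n)) ->
  uniform_lim F f -> uniform_lim W w -> lifts f w.
Proof.
  intros HL HF HW. split.
  (* A jump contains two evaluations of [f]; with the errors of [W n] and of its lifting property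
     this makes four quarters. *)
  - intros j eps He. destruct (HF (eps / 4) ltac:(lra)) as [N HN].
    destruct (HW (eps / 4) ltac:(lra)) as [N' HN'].
    set (n := Nat.max N N'). specialize (HN n ltac:(lia)). specialize (HN' n ltac:(lia)).
    destruct (HL n) as [H1 _]. destruct (H1 j (eps / 4) ltac:(lra)) as [M HM].
    exists M. intros m Hm. specialize (HM m Hm). specialize (HN' (node j m)).
    unfold jump in *.
    pose proof (HN (indicator (fun k => k = u (j m) \/ k = v j))) as Ha.
    pose proof (HN (indicator (fun k => k = u (j m)))) as Hb.
    cbv beta in Ha, Hb, HN'. apply Rabs_le_bounds in Ha, Hb, HN', HM.
    apply Rabs_le. lra.
  - intros eps He. destruct (HW (eps / 2) ltac:(lra)) as [N HN].
    specialize (HN N (Nat.le_refl N)). destruct (HL N) as [_ H2].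
    destruct (H2 (eps / 2) ltac:(lra)) as (L & M & HM).
    exists L, M. intros n Hn Hoff. specialize (HM n Hn Hoff). specialize (HN n).
    cbv beta in HN. apply Rabs_le_bounds in HN, HM. apply Rabs_le. lra.
Qed.

(** At each node [w] takes the jump of a branch through it that is dominant up to a factor 2, and 0
    at numbers that code no node. *)
Lemma lifts_exists f : prod_continuous f ->
  exists w r, lifts f w /\ supnorm_le w r.
Proof.
  intro Hf. destruct (prod_continuous_bounded f Hf) as [r Hr].
  assert (Hjump : forall a j, Rabs (jump f a j) <= 2 * r).
  { intros a j. unfold jump.
    pose proof (Hr (indicator (fun k => k = u a \/ k = v j))) as Ha.
    pose proof (Hr (indicator (fun k => k = u a))) as Hb.
    apply Rabs_le_bounds in Ha, Hb. apply Rabs_le. lra. }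
  destruct (choice_on (fun n x =>
    (exists j m, node j m = n /\ x = jump f (j m) j /\
       forall j' m', node j' m' = n -> Rabs (jump f (j' m') j') <= 2 * Rabs x) \/
    ((forall j m, node j m <> n) /\ x = 0))) as [w Hw].
  { intro n. destruct (classic (exists p : (nat -> nat) * nat, node (fst p) (snd p) = n))
      as [Hn|Hn].
    - destruct (near_maximizer (fun p : (nat -> nat) * nat => node (fst p) (snd p) = n)
                  (fun p => jump f (fst p (snd p)) (fst p)) (2 * r) Hn) as [[j m] [Hjm Hmax]].
      + intros [j m]. apply Hjump.
      + exists (jump f (j m) j). left. exists j, m. split; [exact Hjm|].
        split; [reflexivity|]. intros j' m' H'. exact (Hmax (j', m') H').
    - exists 0. right. split; [|reflexivity]. intros j m H. apply Hn. now exists (j, m). }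
  exists w, (2 * r). split; [split|].
  (* If the dominant branch is in [L], it is [j] itself far enough up. Otherwise its jump is at most
     eps/3, so that of [j] is at most 2 eps/3. *)
  - intros j eps He. destruct (jump_small f (eps / 3) Hf ltac:(lra)) as [L HL].
    destruct (node_eventually_separated L j) as [M HM].
    exists M. intros m Hm.
    destruct (Hw (node j m)) as [(j' & m' & Heq & -> & Hmax)|[Hno _]].
    + destruct (classic (In j' L)) as [Hj'|Hj'].
      * pose proof (HM m Hm j' m' Hj' Heq) as Hj. subst j'.
        apply node_inj in Heq as [-> _]. rewrite Rminus_diag, Rabs_R0. lra.
      * specialize (Hmax j m eq_refl). pose proof (HL j' Hj' (j' m')) as Hsmall.
        assert (Hj : Rabs (jump f (j m) j) <= 2 * (eps / 3)) by lra.
        apply Rabs_le_bounds in Hsmall, Hj. apply Rabs_le. lra.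
    + now destruct (Hno j m).
  - intros eps He. destruct (jump_small f eps Hf He) as [L HL].
    exists L, O. intros n _ Hoff.
    destruct (Hw n) as [(j & m & Heq & -> & _)|[_ ->]].
    + apply HL. intro Hj. exact (Hoff j m Hj Heq).
    + rewrite Rabs_R0. lra.
  - intro n. destruct (Hw n) as [(j & m & _ & -> & _)|[_ ->]]; [apply Hjump|].
    rewrite Rabs_R0. pose proof (Rabs_pos (jump f O (fun _ => O))).
    specialize (Hjump O (fun _ => O)). lra.
Qed.

(** A pair (f, w) is encoded as one function on a disjoint sum, so that the maximum of the two sup
    norms is again a sup norm and [function_banach] applies. *)
Definition pullback (g : (kappa -> bool) + nat -> R) : Prop :=
  prod_continuous (fun x => g (inl x)) /\ (exists r, supnorm_le g r) /\
  lifts (fun x => g (inl x)) (fun n => g (inr n)).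

Lemma pullback_zero : pullback (fun _ => 0).
Proof.
  split; [apply prod_continuous_zero|split].
  - exists 0. intro t. rewrite Rabs_R0. lra.
  - apply lifts_zero. intros eps He. exists O. intros n _. unfold Rdist.
    rewrite Rminus_diag, Rabs_R0. exact He.
Qed.

Lemma pullback_linear a f g : pullback f -> pullback g -> pullback (fun t => f t + a * g t).
Proof.
  intros (Hf & [r Hr] & Hfl) (Hg & [s Hs] & Hgl). split; [|split].
  - now apply prod_continuous_linear with (f := fun x => f (inl x)) (g := fun x => g (inl x)).
  - exists (r + Rabs a * s). intro t. eapply Rle_trans; [apply Rabs_triang|].
    rewrite Rabs_mult. apply Rplus_le_compat; [apply Hr|].
    apply Rmult_le_compat_l; [apply Rabs_pos|apply Hs].
  - now apply (lifts_linear a (fun x => f (inl x)) (fun n => f (inr n))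
                 (fun x => g (inl x)) (fun n => g (inr n))).
Qed.

Lemma pullback_bounded f : pullback f -> exists r, supnorm_le f r.
Proof. now intros (_ & H & _). Qed.

Lemma pullback_closed (F : nat -> (kappa -> bool) + nat -> R) f :
  (forall n, pullback (F n)) -> uniform_lim F f -> pullback f.
Proof.
  intros HF Hlim.
  assert (Hl : uniform_lim (fun n x => F n (inl x)) (fun x => f (inl x))).
  { intros eps He. destruct (Hlim eps He) as [N HN]. exists N. intros n Hn x.
    apply (HN n Hn (inl x)). }
  split; [|split].
  - apply (prod_continuous_lim (fun n x => F n (inl x))); [|exact Hl]. intro n. apply HF.
  - destruct (Hlim 1 ltac:(lra)) as [N HN]. specialize (HN N (Nat.le_refl N)).
    destruct (HF N) as (_ & [r Hr] & _). exists (r + 1). intro t.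
    specialize (HN t). specialize (Hr t). cbv beta in HN.
    apply Rabs_le_bounds in HN, Hr. apply Rabs_le. lra.
  - apply (lifts_lim (fun n x => F n (inl x)) (fun n m => F n (inr m))); [|exact Hl|].
    + intro n. apply HF.
    + intros eps He. destruct (Hlim eps He) as [N HN]. exists N. intros n Hn m.
      apply (HN n Hn (inr m)).
Qed.

Definition pullback_banach : Banach :=
  function_banach pullback pullback_zero pullback_linear pullback_bounded pullback_closed.

Lemma c0_in_pullback (y : c0) :
  pullback (fun t => match t with inl _ => 0 | inr n => proj1_sig y n end).
Proof.
  destruct y as [y Hy]. simpl. split; [apply prod_continuous_zero|split].
  - destruct (maj_by_pos y (exist _ 0 Hy)) as [r [Hr0 Hr]]. exists r.
    intros [x|n]; [rewrite Rabs_R0; lra|apply Hr].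
  - now apply lifts_zero.
Qed.

Definition twisted_sum : TwistedSum kappa.
Proof.
  refine {| tw_Z := pullback_banach;
            tw_i := fun y => exist _ _ (c0_in_pullback y);
            tw_q := fun z => exist _ (fun x => proj1_sig z (inl x)) (proj1 (proj2_sig z)) |}.
  - intros a y1 y2 y3 H. apply fs_ext. intros [x|n]; simpl; [ring|apply H].
  - exists 1. intros y r Hr.
    assert (H0 : 0 <= r) by (eapply Rle_trans; [apply Rabs_pos|apply (Hr O)]).
    rewrite Rmult_1_l. apply function_space_norm_le; [exact H0|].
    intros [x|n]; simpl; [rewrite Rabs_R0; exact H0|apply Hr].
  - reflexivity.
  - exists 1. intros z x. rewrite Rmult_1_l. apply (function_space_norm_bound _ _ _ _ z (inl x)).
  - intros y1 y2 H n. apply (f_equal (fun z => proj1_sig z (inr n))) in H. exact H.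
  - intro z. split.
    + intros [y <-] t. reflexivity.
    + intro Hz. destruct z as [z Hpb]. simpl in Hz. pose proof Hpb as (_ & _ & Hl).
      assert (Hz0 : (fun x => z (inl x)) = (fun _ => 0)).
      { now apply functional_extensionality. }
      rewrite Hz0 in Hl. apply lifts_zero in Hl.
      exists (exist (fun y => Un_cv y 0) _ Hl). apply fs_ext. intros [x|n]; simpl; [symmetry; apply Hz|reflexivity].
  - intros [f Hf]. destruct (lifts_exists f Hf) as (w & r & Hw & Hr).
    destruct (prod_continuous_bounded f Hf) as [r' Hr'].
    assert (Hz : pullback (fun t => match t with inl x => f x | inr n => w n end)).
    { split; [exact Hf|split; [|exact Hw]]. exists (Rmax r r'). intros [x|n].
      - eapply Rle_trans; [apply Hr'|apply Rmax_r].
      - eapply Rle_trans; [apply Hr|apply Rmax_l]. }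
    exists (exist _ _ Hz). reflexivity.
Defined.
(** * Nontriviality *)

(** The function 1_{U_a} x_{v j}. *)
Definition test (a : nat) (j : nat -> nat) (x : kappa -> bool) : R :=
  if x (u a) && x (v j) && forallb (fun b => negb (x (u b))) (seq 0 a) then 1 else 0.

Lemma test_continuous a j : prod_continuous (test a j).
Proof.
  intros x eps He. exists (u a :: v j :: map u (seq 0 a)). intros y Hy.
  replace (test a j y) with (test a j x); [now rewrite Rminus_diag, Rabs_R0|].
  unfold test. rewrite (Hy (u a)), (Hy (v j)) by (simpl; tauto).
  replace (forallb (fun b => negb (y (u b))) (seq 0 a))
    with (forallb (fun b => negb (x (u b))) (seq 0 a)); [reflexivity|].
  assert (Hs : forall b, In b (seq 0 a) -> y (u b) = x (u b)).
  { intros b Hb. apply Hy. right. right. now apply in_map. }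
  clear Hy. induction (seq 0 a) as [|b l IH]; [reflexivity|]. simpl.
  rewrite Hs by now left. rewrite IH; [reflexivity|].
  intros b' Hb'. apply Hs. now right.
Qed.

Lemma jump_test a j : jump (test a j) a j = 1.
Proof.
  unfold jump, test.
  rewrite (indicator_false (fun k => k = u a) (v j)) by (intro H; now apply (uv_disjoint a j)).
  rewrite andb_false_r, !indicator_true by tauto. simpl.
  replace (forallb _ (seq 0 a)) with true; [ring|].
  symmetry. apply forallb_forall. intros b Hb. apply in_seq in Hb.
  rewrite indicator_false; [reflexivity|]. intros [H|H].
  - apply u_inj in H. lia.
  - now apply (uv_disjoint b j).
Qed.

(** The factor 1 gives the recursion the shape of a linear combination in [G_linear]. *)
Fixpoint test_sum (J : nat -> nat -> nat) (M : nat) (x : kappa -> bool) : R :=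
  match M with O => 0 | S a => test_sum J a x + 1 * test a (J a) x end.

(** The second clause drives the induction: where the new summand is 1, [x] vanishes at all earlier
    [u b], so the earlier sum is 0. *)
Lemma test_sum_bounds J M x : 0 <= test_sum J M x <= 1 /\
  ((forall b, (b < M)%nat -> x (u b) = false) -> test_sum J M x = 0).
Proof.
  induction M as [|M [IH1 IH2]]; cbn [test_sum].
  - split; [lra|reflexivity].
  - unfold test. destruct (x (u M)) eqn:HM; simpl.
    + split.
      * destruct (x (v (J M)) && _) eqn:Hx; [|lra].
        apply andb_prop in Hx as [_ Hx].
        rewrite forallb_forall in Hx. rewrite IH2; [lra|].
        intros b Hb. apply negb_true_iff, Hx, in_seq. lia.
      * intro H. rewrite H in HM by lia. discriminate HM.
    + split; [lra|]. intro H. rewrite IH2; [ring|]. intros b Hb. apply H. lia.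
Qed.

Lemma test_sum_continuous J M : prod_continuous (test_sum J M).
Proof.
  induction M as [|M IH]; [apply prod_continuous_zero|].
  exact (prod_continuous_linear 1 _ _ IH (test_continuous M (J M))).
Qed.

Lemma twisted_sum_nontrivial : ~ trivial_twisted_sum twisted_sum.
Proof.
  intros (N & (N0 & Nadd & Nscal) & Nclosed & Ndisj & Nsum).
  change (pullback_banach -> Prop) in N.
  (* [G] is the graph of the lifting whose values are read off from the complement [N]. *)
  set (G := fun f w => exists z : pullback_banach, N z /\
    (forall x, proj1_sig z (inl x) = f x) /\ (forall n, proj1_sig z (inr n) = w n)).
  assert (G_lifts : forall f w, G f w -> prod_continuous f /\ lifts f w).
  { intros f w (z & _ & Hf & Hw). apply functional_extensionality in Hf, Hw. subst f w.
    destruct (proj2_sig z) as (H1 & _ & H2). now split. }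
  assert (G_zero : G (fun _ => 0) (fun _ => 0)).
  { exists ns_zero. split; [exact N0|]. now split. }
  assert (G_linear : forall a f w g y, G f w -> G g y ->
            G (fun x => f x + a * g x) (fun n => w n + a * y n)).
  { intros a f w g y (z1 & Hz1 & Hf & Hw) (z2 & Hz2 & Hg & Hy).
    exists (ns_add z1 (ns_scal a z2)). split; [apply Nadd; [|apply Nscal]; assumption|].
    split; [intro x; simpl; now rewrite Hf, Hg|intro n; simpl; now rewrite Hw, Hy]. }
  assert (G_unique : forall f w w', G f w -> G f w' -> forall n, w n = w' n).
  { intros f w w' Hw Hw' n.
    (* The difference of two lifts of [f] lies in [N] and over 0, hence also in the image of c_0. *)
    destruct (G_linear (-1) _ _ _ _ Hw Hw') as (z & Hz & Hf & Hy).
    assert (Hz0 : z = ns_zero).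
    { apply Ndisj; [|exact Hz]. apply (tw_exact _ twisted_sum). intro x. simpl.
      rewrite Hf. ring. }
    specialize (Hy n). rewrite Hz0 in Hy. simpl in Hy. lra. }
  assert (G_total : forall f, prod_continuous f <-> exists w, G f w).
  { intro f. split; [|now intros [w Hw]; apply (G_lifts f w)].
    intro Hf. destruct (tw_q_surj _ twisted_sum (exist _ f Hf)) as [z Hz].
    (* Removing the c_0 part of a preimage of [f] leaves an element of [N] still lying over [f]. *)
    destruct (Nsum z) as (m & w & [y Hm] & Hw & Hzm).
    exists (fun n => proj1_sig (w : pullback_banach) (inr n)).
    exists w. split; [exact Hw|]. split; [|reflexivity]. intro x.
    specialize (Hz x). simpl in Hz. rewrite <- Hz, Hzm, <- Hm. simpl. ring. }
  destruct (open_mapping prod_continuous G) as [C HC].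
  - exact G_zero.
  - exact G_linear.
  - intros F W f w HFW HF HW.
    destruct (choice_on _ HFW) as [z Hz].
    set (g := fun t => match t with inl x => f x | inr n => w n end).
    assert (Hlim : uniform_lim (fun n => proj1_sig (z n)) g).
    { intros eps He. destruct (HF eps He) as [M HM]. destruct (HW eps He) as [M' HM'].
      exists (Nat.max M M'). intros n Hn. destruct (Hz n) as (_ & H1 & H2).
      intros [x|k]; simpl.
      - rewrite H1. apply HM. lia.
      - rewrite H2. apply HM'. lia. }
    pose proof (pullback_closed _ g (fun n => proj2_sig (z n)) Hlim) as Hg.
    exists (exist _ g Hg). split; [|now split].
    apply (Nclosed z); [intro n; apply Hz|]. now apply function_space_converges.
  - intros f w (z & _ & _ & Hw). destruct (proj2_sig z) as (_ & [r Hr] & _).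
    exists r. intro n. rewrite <- Hw. apply Hr.
  - exact G_total.
  - exact prod_continuous_lim.
  - destruct (choice_on _ (fun p => proj1 (G_total _) (test_continuous (fst p) (snd p))))
      as [W HW].
    (* With M > 2C, a value of at least M/2 at one node exceeds the bound [C]. *)
    destruct (INR_unbounded (2 * C)) as [M HM].
    (* Only labels below [M] are considered, so one threshold serves for all of them; 1/2 is the
       jump 1 minus an error of 1/2. *)
    assert (HN : forall j, exists K, forall m, (K <= m)%nat -> (j m < M)%nat ->
              / 2 <= W (j m, j) (node j m)).
    { intro j. clear HM. induction M as [|M [K HK]].
      - exists O. intros m _ Hm. lia.
      - destruct (G_lifts _ _ (HW (M, j))) as [_ [Hl _]].
        destruct (Hl j (/ 2) ltac:(lra)) as [K' HK']. exists (Nat.max K K').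
        intros m Hm Hjm. destruct (Nat.eq_dec (j m) M) as [Heq|Hne]; [|apply HK; lia].
        specialize (HK' m ltac:(lia)). rewrite Heq in HK' |- *. simpl in HK'.
        rewrite jump_test in HK'. apply Rabs_le_bounds in HK'. lra. }
    apply choice_on in HN as [K HK].
    destruct (branches_at_common_node M K) as (s & m & Hs).
    destruct (choice_on (fun a j => (a < M)%nat -> node j m = s /\ j m = a /\ (K j <= m)%nat))
      as [J HJ].
    { intro a. destruct (classic (a < M)%nat) as [Ha|Ha].
      - destruct (Hs a Ha) as [j Hj]. now exists j.
      - exists (fun _ => O). intro H. contradiction. }
    assert (Hsum : forall M', (M' <= M)%nat ->
              exists w, G (test_sum J M') w /\ INR M' / 2 <= w s).
    { intro M'. induction M' as [|M' IH]; intro HM'.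
      - exists (fun _ => 0). split; [exact G_zero|]. simpl. lra.
      - destruct (IH ltac:(lia)) as (w & Hw & Hws).
        exists (fun n => w n + 1 * W (M', J M') n). split.
        + exact (G_linear 1 _ _ _ _ Hw (HW (M', J M'))).
        + destruct (HJ M' HM') as (H1 & H2 & H3).
          specialize (HK (J M') m H3 ltac:(lia)). rewrite H1, H2 in HK.
          rewrite S_INR. lra. }
    destruct (Hsum M (Nat.le_refl M)) as (w & Hw & Hws).
    (* Open mapping yields a lift bounded by [C]; by uniqueness it is the lift [w] that is large at
       [s]. *)
    destruct (HC (test_sum J M) (test_sum_continuous J M)) as (w' & Hw' & HwC).
    { intro x. destruct (test_sum_bounds J M x) as [Hb _]. rewrite Rabs_right; lra. }
    specialize (HwC s). rewrite <- (G_unique _ _ _ Hw Hw' s) in HwC.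
    apply Rabs_le_bounds in HwC. lra.
Qed.
End Construction.

(** * An embedding of the set of sequences of natural numbers into the reals *)

(** Digits 0 and 1 in base 3: a digit 1 exceeds the sum of all later digits, which makes expansions
    unique. *)
Fixpoint ternary (b : nat -> bool) (n : nat) : R :=
  match n with O => 0 | S n => ternary b n + (if b n then (/ 3) ^ n else 0) end.

Lemma third_pow_pos n : 0 < (/ 3) ^ n.
Proof. apply pow_lt. lra. Qed.

Lemma ternary_tail b n k :
  ternary b n <= ternary b (n + k) <= ternary b n + 3 / 2 * ((/ 3) ^ n - (/ 3) ^ (n + k)).
Proof.
  induction k as [|k IH].
  - rewrite Nat.add_0_r. lra.
  - rewrite Nat.add_succ_r. cbn [ternary pow]. pose proof (third_pow_pos (n + k)).
    destruct (b (n + k)%nat); lra.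
Qed.

Lemma bool_sequences_into_R : exists e : (nat -> bool) -> R, forall b c, e b = e c -> b = c.
Proof.
  destruct (choice_on (fun b x => is_lub (fun y => exists n, y = ternary b n) x)) as [e He].
  { intro b. destruct (completeness (fun y => exists n, y = ternary b n)) as [x Hx].
    - exists (3 / 2). intros y [n ->]. pose proof (ternary_tail b O n) as H.
      pose proof (third_pow_pos n). simpl in H. lra.
    - exists 0. now exists O.
    - now exists x. }
  assert (Hlt : forall n b c, (forall i, (i < n)%nat -> b i = c i) ->
            b n = true -> c n = false -> e c < e b).
  { intros n b c Heq Hb Hc. pose proof (third_pow_pos n) as Hp.
    assert (Hn : ternary b n = ternary c n).
    { clear Hb Hc Hp. induction n as [|n IH]; [reflexivity|]. cbn [ternary].
      rewrite IH, Heq; [reflexivity|lia|]. intros i Hi. apply Heq. lia. }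
    assert (H1 : ternary b (S n) <= e b) by (apply (He b); now exists (S n)).
    assert (H2 : e c <= ternary c (S n) + 3 / 2 * (/ 3) ^ S n).
    { apply (He c). intros y [k ->].
      pose proof (ternary_tail c (S n) k) as H. pose proof (third_pow_pos (S n + k)).
      (* Comparing both [k] and [S n] with their sum avoids a case distinction on which is
         larger. *)
      pose proof (ternary_tail c k (S n)) as H'. rewrite Nat.add_comm in H'. lra. }
    cbn [ternary pow] in H1, H2. rewrite Hb in H1. rewrite Hc in H2. lra. }
  exists e. intros b c Hbc. apply functional_extensionality. intro n.
  induction n as [n IH] using (well_founded_induction lt_wf).
  destruct (b n) eqn:Hb, (c n) eqn:Hc; try reflexivity; exfalso.
  - specialize (Hlt n b c IH Hb Hc). lra.
  - specialize (Hlt n c b (fun i Hi => eq_sym (IH i Hi)) Hc Hb). lra.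
Qed.

(** A sequence is coded by the characteristic function of its graph. *)
Lemma nat_sequences_into_R : exists e : (nat -> nat) -> R, forall i j, e i = e j -> i = j.
Proof.
  destruct bool_sequences_into_R as [e He].
  exists (fun j => e (fun n => Nat.eqb (j (fst (of_nat n))) (snd (of_nat n)))).
  intros i j Hij. apply He in Hij. apply functional_extensionality. intro m.
  apply (f_equal (fun b => b (to_nat (m, i m)))) in Hij.
  rewrite cancel_of_to in Hij. cbn [fst snd] in Hij. rewrite Nat.eqb_refl in Hij.
  symmetry. apply Nat.eqb_eq. now symmetry.
Qed.

(* kappa is a cardinal >= continuum: represented by a type admitting an injection from R. *)
Theorem theorem3p5 (kappa : Type)
  (Hkappa : exists j : R -> kappa, forall a b : R, j a = j b -> a = b) :
  exists T : TwistedSum kappa, ~ trivial_twisted_sum T.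
Proof.
  destruct Hkappa as [h Hh]. destruct nat_sequences_into_R as [e He].
  (* The leading entry 0 or 1 makes the ranges of [u] and [v] disjoint. *)
  set (cons := fun (a : nat) (j : nat -> nat) n => match n with O => a | S n => j n end).
  set (u := fun a => h (e (cons O (fun _ => a)))).
  set (v := fun j => h (e (cons 1%nat j))).
  assert (Hu : forall a b, u a = u b -> a = b).
  { intros a b H. apply Hh, He in H. exact (f_equal (fun j => j 1%nat) H). }
  assert (Hv : forall i j, v i = v j -> i = j).
  { intros i j H. apply Hh, He in H. apply functional_extensionality. intro n.
    exact (f_equal (fun j => j (S n)) H). }
  assert (Huv : forall a j, u a <> v j).
  { intros a j H. apply Hh, He in H. apply (f_equal (fun j => j O)) in H. discriminate H. }
  exists (twisted_sum u v Hu Hv). now apply twisted_sum_nontrivial.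
Qed.
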